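(* Let $K$ be a strictly convex hypersurface in $\mathbb{R}^n$, let $\Omega=\mathbb{R}^n\setminus\overline{K}$ with its partial order $<$, and let $F$ be the timelike Funk distance. For any $x\in\Omega$ and any real $M>0$, the set \[ S_M(x)=\{p\in\Omega : p<x \text{ and } F(p,x)>M\} \] is a convex subset of $\Omega$.
   Context: $I\subset\mathbb{R}^n$ is a nonempty open convex set, $I\neq\mathbb{R}^n$ (possibly unbounded), $K=\partial I$, $\overline{K}=K\cup I$, $\Omega=\mathbb{R}^n\setminus\overline{K}$. $K$ strictly convex means that $K$ contains no nondegenerate Euclidean segment. A supporting hyperplane of $K$ is a hyperplane $\pi$ with $\pi\cap K\neq\emptyset$ and such that $I$ is contained in one of the two components of $\mathbb{R}^n\setminus\pi$. $d$ is Euclidean distance. Order: for distinct $p,q\in\Omega$, $p<q$ means: (1) the Euclidean ray $R(p,q)$ from $p$ through $q$ intersects $K$; (2) $R(p,q)$ is not contained in a supporting hyperplane of $K$; (3) the closed segment $[p,q]$ does not intersect $K$. Timelike Funk distance: for $p<q$, $F(p,q)=\log\frac{d(p,b(p,q))}{d(q,b(p,q))}$, where $b(p,q)$ is the first intersection point of $R(p,q)$ with $K$. A convex subset of $\Omega$ is a subset of $\Omega$ that is convex in $\mathbb{R}^n$. *)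

(* Defs.v *)
From HB Require Import structures.
From mathcomp Require Import all_boot all_order all_algebra.
From mathcomp Require Import all_classical all_reals all_analysis.

Set Implicit Arguments.
Unset Strict Implicit.
Unset Printing Implicit Defensive.

Import Order.TTheory GRing.Theory Num.Theory.
Import numFieldNormedType.Exports.

Local Open Scope classical_set_scope.
Local Open Scope ring_scope.

(* R^n is 'rV[R]_n. Its library topology is the product topology, i.e. the
   Euclidean one, but its library norm is the sup norm, so the Euclidean
   distance is defined separately. *)

Definition dotv (R : realType) (n : nat) (u v : 'rV[R]_n) : R :=
  \sum_(i < n) u 0 i * v 0 i.

Definition edist (R : realType) (n : nat) (p q : 'rV[R]_n) : R :=
  Num.sqrt (dotv (p - q) (p - q)).

Definition segment (R : realType) (n : nat) (p q : 'rV[R]_n) : set 'rV[R]_n :=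
  [set p + t *: (q - p) | t in [set t : R | 0 <= t <= 1]].

Definition ray (R : realType) (n : nat) (p q : 'rV[R]_n) : set 'rV[R]_n :=
  [set p + t *: (q - p) | t in [set t : R | 0 <= t]].

Definition boundary (T : topologicalType) (A : set T) : set T :=
  closure A `\` interior A.

(* In the definitions below, I is the open convex set, K = boundary I. *)

Definition exterior (R : realType) (n : nat) (I : set 'rV[R]_n) :
    set 'rV[R]_n :=
  ~` (boundary I `|` I).

Definition strictly_convex (R : realType) (n : nat) (K : set 'rV[R]_n) : Prop :=
  ~ exists p q : 'rV[R]_n, p != q /\ segment p q `<=` K.

(* The components of the complement of the hyperplane {z | <a, z> = c} are the
   two open half-spaces {z | <a, z> < c} and {z | <a, z> > c}. *)
Definition supporting_hyperplane (R : realType) (n : nat)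
    (I H : set 'rV[R]_n) : Prop :=
  exists (a : 'rV[R]_n) (c : R),
    [/\ a != 0,
        H = [set z | dotv a z = c],
        H `&` boundary I !=set0 &
        I `<=` [set z | dotv a z < c] \/ I `<=` [set z | c < dotv a z]].

Definition chron_lt (R : realType) (n : nat) (I : set 'rV[R]_n)
    (p q : 'rV[R]_n) : Prop :=
  [/\ [/\ exterior I p, exterior I q & p != q],
      ray p q `&` boundary I !=set0,
      ~ (exists H, supporting_hyperplane I H /\ ray p q `<=` H) &
      segment p q `&` boundary I = set0].

Definition first_hit (R : realType) (n : nat) (K : set 'rV[R]_n)
    (p q b : 'rV[R]_n) : Prop :=
  exists t : R,
    [/\ 0 <= t, b = p + t *: (q - p), K b &
        forall s : R, 0 <= s < t -> ~ K (p + s *: (q - p))].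

(* [get] returns the element of a nonempty set chosen by the library; by
   [hit_pointP] and [first_hit_uniq] this is the first intersection point of
   the ray with the closed set K whenever they intersect. *)
Definition hit_point (R : realType) (n : nat) (K : set 'rV[R]_n)
    (p q : 'rV[R]_n) : 'rV[R]_n :=
  get (first_hit K p q).

Definition funk (R : realType) (n : nat) (I : set 'rV[R]_n)
    (p q : 'rV[R]_n) : R :=
  let b := hit_point (boundary I) p q in
  ln (edist p b / edist q b).

Definition funk_set (R : realType) (n : nat) (I : set 'rV[R]_n)
    (x : 'rV[R]_n) (M : R) : set 'rV[R]_n :=
  [set p | [/\ exterior I p, chron_lt I p x & M < funk I p x]].

Lemma first_hit_uniq (R : realType) (n : nat) (K : set 'rV[R]_n)
    (p q b b' : 'rV[R]_n) :
  first_hit K p q b -> first_hit K p q b' -> b = b'.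
Proof.
move=> [t [t0 -> Kt tmin]] [s [s0 -> Ks smin]].
have [ts|st|->//] := ltgtP t s.
  by case: (smin t); rewrite ?t0.
by case: (tmin s); rewrite ?s0.
Qed.

Lemma closed_boundary (T : topologicalType) (A : set T) : closed (boundary A).
Proof.
rewrite /boundary setDE; apply: closedI; first exact: closed_closure.
exact/open_closedC/open_interior.
Qed.

Lemma continuous_line (R : realType) (n : nat) (p v : 'rV[R]_n) :
  continuous (fun t : R => p + t *: v).
Proof.
move=> t; apply/cvg_ballP => e e0.
have h (j : 'I_n) : \forall s \near t, ball (p 0 j + t * v 0 j) e (p 0 j + s * v 0 j).
  have /cvg_ballP : (fun s : R => p 0 j + s * v 0 j) @ t --> p 0 j + t * v 0 j.
    by apply: cvgD; [exact: cvg_cst | apply: cvgMr_tmp; exact: cvg_id].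
  by apply.
apply: filterS (filter_forall _ h) => s hs; split=> // i j.
by rewrite !mxE ord1; apply: hs.
Qed.

Lemma hit_pointP (R : realType) (n : nat) (K : set 'rV[R]_n)
    (p q : 'rV[R]_n) :
  closed K -> ray p q `&` K !=set0 -> first_hit K p q (hit_point K p q).
Proof.
move=> Kc [_ [[t /= t0 <-] Kt]].
pose f (s : R) := p + s *: (q - p).
pose A : set R := [set s | 0 <= s] `&` f @^-1` K.
have Ac : closed A.
  apply: closedI; first exact: closed_ge.
  by apply: preimage_closed => // s _; exact: continuous_line.
have hA : has_inf A by split; [exists t | exists 0 => s []].
have [i0 Ki] : A (inf A).
  suff : closure A (inf A) by rewrite -((closure_id A).1 Ac).
  move=> B /nbhs_ballP[e /= e0 eB].
  have [s As slt] := inf_adherent e0 hA.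
  exists s; split=> //; apply: eB; rewrite /ball /= distrC ger0_norm.
    by rewrite ltrBlDl.
  by rewrite subr_ge0; apply: ge_inf; case: hA.
apply: getPex; exists (f (inf A)), (inf A); split=> // s /andP[s0 si] Ks.
by move: si; rewrite ltNge => /negP; apply; apply: ge_inf; case: hA.
Qed.

(* Main.v *)
(* With [v = x - p], a hit at [p + t v] gives [F(p, x) = ln (t / (t - 1))], so
   [F(p, x) > M] says that the hit occurs before parameter [1 + 1 / nu], where
   [nu = expR M - 1]. As the ray lies in no supporting hyperplane, Hahn-Banach
   separation shows that it enters [I], and it does so right after the hit.
   Hence [S_M(x)] is the set of points [x + r (x - y)] with [y] in [I] and
   [r > nu]; the other conditions of the order are automatic because [x] is
   outside the closure of the convex set [I]. A convex combination of
   [x + r1 (x - y1)] and [x + r2 (x - y2)] is again of that form, with [r] a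
   convex combination of [r1, r2] and [y] one of [y1, y2]. *)
Require Import Defs.
From mathcomp Require Import all_boot all_order all_algebra.
From mathcomp Require Import all_classical all_reals all_analysis.
From mathcomp Require Import ring.

Import Order.TTheory GRing.Theory Num.Theory.
Import numFieldNormedType.Exports.
Local Open Scope classical_set_scope.
Local Open Scope ring_scope.

(** * Convex combinations and the Euclidean dot product *)

Lemma convex_set_segment (R : realType) (n : nat) (A : set 'rV[R]_n) :
  convex_set A <-> forall x y (t : R), 0 <= t <= 1 -> A x -> A y ->
    A (t *: x + (1 - t) *: y).
Proof.
split=> [Ac x y t /andP[t0 t1] Ax Ay|Ac x y t].
  by have := Ac x y (Itv01 t0 t1); rewrite !inE; exact.
by rewrite !inE; apply: Ac; rewrite ge0 le1.
Qed.

Section DotProduct.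
Context {R : realType} {n : nat}.
Implicit Types (u v w : 'rV[R]_n) (k : R).

Lemma dotvDr u v w : dotv u (v + w) = dotv u v + dotv u w.
Proof. by rewrite -big_split; apply: eq_bigr => i _; rewrite mxE mulrDr. Qed.

Lemma dotvZr u v k : dotv u (k *: v) = k * dotv u v.
Proof. by rewrite mulr_sumr; apply: eq_bigr => i _; rewrite mxE mulrCA. Qed.

Lemma dotvBr u v w : dotv u (v - w) = dotv u v - dotv u w.
Proof. by rewrite -scaleN1r dotvDr dotvZr mulN1r. Qed.

Lemma dotv_gt0 u : u != 0 -> 0 < dotv u u.
Proof.
move=> u0; rewrite lt_def sumr_ge0 ?andbT; last by move=> i _; rewrite -expr2 sqr_ge0.
apply: contra_neq u0 => /eqP; rewrite psumr_eq0; last first.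
  by move=> i _; rewrite -expr2 sqr_ge0.
move=> /allP u0; apply/rowP => i; rewrite mxE.
by have := u0 i (mem_index_enum i); rewrite /= mulf_eq0 orbb => /eqP.
Qed.

End DotProduct.

(** * Pointed cones and positive linear functionals *)

Section OrderedCones.
Context {R : realType} {n : nat}.
Implicit Types (W : set 'rV[R]_n) (e x y z : 'rV[R]_n) (c k : R).

Definition pointed_cone W :=
  [/\ forall x y, W x -> W y -> W (x + y),
      forall k x, 0 <= k -> W x -> W (k *: x) &
      forall x, W x -> W (- x) -> x = 0].

(* A maximal pointed cone is total: if neither [z] nor [-z] lies in [A], then
   adjoining the half-line through [z] keeps [A] pointed. *)
Lemma pointed_cone_total W :
  pointed_cone W -> W !=set0 ->
  exists A, [/\ pointed_cone A, W `<=` A & forall z, A z \/ A (- z)].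
Proof.
move=> Wcone [w0 Ww0].
(* The guard [B !=set0] lets the empty set, the union of the empty chain, satisfy [P]. *)
pose P B := pointed_cone B /\ (B !=set0 -> W `<=` B).
have [|A [[[Aadd Ascale Apt] WA] Amax]] := @Zorn_bigcup _ P.
  move=> F FP Ftot; split; last first.
    move=> [z [X FX Xz]] w Ww; exists X => //.
    by apply: (FP _ FX).2 => //; exists z.
  have both x y : (\bigcup_(X in F) X) x -> (\bigcup_(X in F) X) y ->
      exists X, [/\ F X, X x & X y].
    move=> [X FX Xx] [Y FY Yy].
    by have [XY|YX] := Ftot _ _ FX FY; [exists Y|exists X]; split=> //;
      [exact: XY|exact: YX].
  split=> [x y Fx Fy|k x k0 [X FX Xx]|x Fx FNx].
  - have [X [FX Xx Xy]] := both _ _ Fx Fy.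
    by exists X => //; have [[+ _ _] _] := FP _ FX; exact.
  - by exists X => //; have [[_ + _] _] := FP _ FX; exact.
  - have [X [FX Xx Xy]] := both _ _ Fx FNx.
    by have [[_ _ +] _] := FP _ FX; exact.
have A0 : A !=set0.
  apply/set0P/eqP => A0.
  apply: (Amax W); last by split=> // _.
  by rewrite A0; split=> [w //|W0]; exact: (W0 _ Ww0).
have {}WA := WA A0.
have Azero : A 0.
  by case: A0 => a Aa; rewrite -(scale0r a); exact: Ascale.
exists A; split=> // z; apply: contrapT => /not_orP[Az ANz].
apply: (Amax [set u + k *: z | u in A & k in [set k | 0 <= k]]).
  split=> [u Au|/(_ z)]; first by exists u => //; exists 0 => /=; rewrite ?scale0r ?addr0.
  by move=> /(_ _)/Az; apply; exists 0 => //; exists 1 => /=; rewrite ?ler01 // scale1r add0r.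
split; last first.
  by move=> _ w /WA Aw; exists w => //; exists 0 => /=; rewrite ?scale0r ?addr0.
split.
- move=> _ _ [u Au [k /= k0 <-]] [v Av [l /= l0 <-]].
  exists (u + v); first exact: Aadd.
  by exists (k + l) => /=; [exact: addr_ge0|rewrite scalerDl addrACA].
- move=> l _ l0 [u Au [k /= k0 <-]].
  exists (l *: u); first exact: Ascale.
  by exists (l * k) => /=; [exact: mulr_ge0|rewrite scalerDr scalerA].
- move=> _ [u Au [k /= k0 <-]] [v Av [l /= l0 uv]].
  have sumE : u + v = - ((k + l) *: z).
    have -> : v = - (u + k *: z) - l *: z by rewrite -uv addrK.
    by apply/rowP => i; rewrite !mxE; ring.
  (* If [k + l > 0], then [- z] is a positive multiple of [u + v] and lies in [A]; otherwise [k = 0]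
     and [v = - u], so pointedness of [A] applies. *)
  have [kl0|kl0] := eqVneq (k + l) 0; last first.
    have kl : 0 < k + l by rewrite lt_def kl0 addr_ge0.
    case: ANz; have -> : - z = (k + l)^-1 *: (u + v).
      by rewrite sumE scalerN scalerA mulVf // scale1r.
    by apply: Ascale; [rewrite invr_ge0 ltW|exact: Aadd].
  have k00 : k = 0 by apply/eqP; rewrite eq_le k0 andbT -kl0 lerDl.
  rewrite k00 scale0r addr0; apply: Apt => //.
  suff -> : - u = v by [].
  by apply/eqP; rewrite eq_sym -addr_eq0 addrC sumE kl0 scale0r oppr0.
Qed.

(* In the order with positive cone [W], [z] equals [c *: e] up to arbitrarily
   small multiples of [e]. *)
Definition order_coord W e z c :=
  forall eps, 0 < eps -> W (z - (c - eps) *: e) /\ W ((c + eps) *: e - z).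

(** The coordinate is the supremum of the [s] with [z - s *: e] in [W]. It is finite because [e] is
    an order unit and [W] is pointed; totality of [W] gives the upper estimate. *)
Lemma order_coord_exists W e :
  pointed_cone W -> (forall z, W z \/ W (- z)) -> W e -> e != 0 ->
  (forall z, exists k, W (k *: e - z)) ->
  forall z, exists c, order_coord W e z c.
Proof.
move=> [Wadd Wscale Wpt] Wtot We e0 unit z.
pose S : set R := [set s | W (z - s *: e)].
have supS : has_sup S.
  split.
    have [k] := unit (- z); rewrite opprK addrC => Wk.
    by exists (- k); rewrite /S /= scaleNr opprK.
  have [k Wk] := unit z; exists k => s /= Ws.
  rewrite leNgt; apply/negP => ks; move/eqP: e0; apply; apply: Wpt => //.
  have -> : - e = (s - k)^-1 *: ((k *: e - z) + (z - s *: e)).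
    by apply/rowP => i; rewrite !mxE; field; rewrite subr_eq0 gt_eqF.
  by apply: Wscale; [rewrite invr_ge0 subr_ge0 ltW|exact: Wadd].
exists (sup S) => eps eps0; split.
  have [s Ss lts] := sup_adherent eps0 supS.
  have -> : z - (sup S - eps) *: e = (z - s *: e) + (s - (sup S - eps)) *: e.
    by apply/rowP => i; rewrite !mxE; ring.
  by apply: Wadd => //; apply: Wscale => //; rewrite subr_ge0 ltW.
have [//|] := Wtot ((sup S + eps) *: e - z).
rewrite opprB => Ss; have := ub_le_sup supS.2 Ss.
by rewrite gerDl leNgt eps0.
Qed.

Lemma order_coordD W e z1 z2 c1 c2 : pointed_cone W ->
  order_coord W e z1 c1 -> order_coord W e z2 c2 ->
  order_coord W e (z1 + z2) (c1 + c2).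
Proof.
move=> [Wadd _ _] zc1 zc2 eps eps0.
have /zc1[W1 W1'] : 0 < eps / 2 by rewrite divr_gt0.
have /zc2[W2 W2'] : 0 < eps / 2 by rewrite divr_gt0.
split; [have := Wadd _ _ W1 W2|have := Wadd _ _ W1' W2']; congr W;
  by apply/rowP => i; rewrite !mxE; field.
Qed.

Lemma order_coordZ W e z c k : pointed_cone W -> W e ->
  order_coord W e z c -> order_coord W e (k *: z) (k * c).
Proof.
move=> [_ Wscale _] We zc eps eps0.
have [k0|k0|->] := ltgtP k 0.
- have /zc[W1 W2] : 0 < eps / - k by rewrite divr_gt0 ?oppr_gt0.
  have Nk0 : 0 <= - k by rewrite oppr_ge0 ltW.
  split; [have := Wscale _ _ Nk0 W2|have := Wscale _ _ Nk0 W1]; congr W;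
  by apply/rowP => i; rewrite !mxE; field; rewrite lt_eqF.
- have /zc[W1 W2] : 0 < eps / k by rewrite divr_gt0.
  have {}k0' := ltW k0.
  split; [have := Wscale _ _ k0' W1|have := Wscale _ _ k0' W2]; congr W;
  by apply/rowP => i; rewrite !mxE; field; rewrite gt_eqF.
- rewrite scale0r mul0r !add0r subr0 scaleNr opprK.
  by split; apply: Wscale => //; exact: ltW.
Qed.

(** For negative [c], adding [z] to the upper estimate at [eps = - c / 2] would put a negative
    multiple of [e] in [W], against pointedness. *)
Lemma order_coord_ge0 W e z c : pointed_cone W -> W e -> e != 0 ->
  order_coord W e z c -> W z -> 0 <= c.
Proof.
move=> [Wadd Wscale Wpt] We /eqP e0 zc Wz; rewrite leNgt; apply/negP => c0.
have /zc[_ W1] : 0 < - c / 2 by rewrite divr_gt0 ?oppr_gt0.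
apply: e0; apply: Wpt => //.
have -> : - e = (- c / 2)^-1 *: (((c + - c / 2) *: e - z) + z).
  by apply/rowP => i; rewrite !mxE; field; rewrite lt_eqF.
by apply: Wscale; [rewrite invr_ge0 ltW // divr_gt0 ?oppr_gt0|exact: Wadd].
Qed.

(** Ensures that the functional built from the coordinates is nonzero. *)
Lemma order_coord_unit_neq0 W e : pointed_cone W -> W e -> e != 0 ->
  ~ order_coord W e e 0.
Proof.
move=> [Wadd Wscale Wpt] We /eqP e0 ec.
have /ec[_ W1] : 0 < 2^-1 :> R by rewrite invr_gt0.
apply: e0; apply: Wpt => //.
have -> : - e = 2 *: ((0 + 2^-1) *: e - e).
  by apply/rowP => i; rewrite !mxE; field.
exact: Wscale.
Qed.

(* The coordinate is linear, hence is the dot product with its values on the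
   standard basis. *)
Lemma total_cone_functional W e :
  pointed_cone W -> (forall z, W z \/ W (- z)) -> W e -> e != 0 ->
  (forall z, exists k, W (k *: e - z)) ->
  exists2 a, a != 0 & forall z, W z -> 0 <= dotv a z.
Proof.
move=> Wc Wtot We e0 unit.
have /choice[c ec] : forall z, exists c, order_coord W e z c.
  exact: order_coord_exists.
pose a : 'rV[R]_n := \row_i c 'e_i.
have az z : order_coord W e z (dotv a z).
  rewrite {1}(row_sum_delta z) /dotv.
  have [_ Wscale _] := Wc.
  apply: (big_ind2 (order_coord W e)).
  - move=> eps eps0; rewrite !add0r subr0 scaleNr opprK.
    by split; apply: Wscale => //; exact: ltW.
  - by move=> *; exact: order_coordD.
  - by move=> i _; rewrite mxE mulrC; exact: order_coordZ.
exists a => [|z Wz]; last exact: (@order_coord_ge0 W e z).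
apply/eqP => a0; apply: (@order_coord_unit_neq0 W e) => //.
by have := az e; rewrite a0 /dotv big1 // => i _; rewrite mxE mul0r.
Qed.
End OrderedCones.

(** * Separation of an open convex set from a convex set *)

Lemma open_absorbing (R : realType) (n : nat) (A : set 'rV[R]_n)
    (y v : 'rV[R]_n) :
  open A -> A y -> exists2 eps : R, 0 < eps & A (y + eps *: v).
Proof.
move=> Ao Ay.
have : \forall t \near (0 : R), A (y + t *: v).
  apply: (@continuous_line R n y v 0); rewrite scale0r addr0.
  exact: open_nbhs_nbhs.
move=> /nbhs_ballP[e /= e0 eA]; exists (e / 2); first by rewrite divr_gt0.
apply: eA; rewrite /ball /= sub0r normrN gtr0_norm ?divr_gt0 //.
by rewrite ltr_pdivrMr // mulr_natr mulr2n ltrDl.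
Qed.

(** Disjointness makes the cone generated by the differences [y - b] pointed; a total pointed cone
    containing it carries a nonzero functional that is nonnegative on it. Openness of [A] supplies
    the order unit and makes the inequality strict. *)
Lemma convex_separation (R : realType) (n : nat) (A B : set 'rV[R]_n) :
  open A -> convex_set A -> A !=set0 -> convex_set B -> B !=set0 ->
  A `&` B = set0 ->
  exists2 a : 'rV[R]_n, a != 0 &
    forall y b, A y -> B b -> dotv a b < dotv a y.
Proof.
move=> Ao /convex_set_segment Ac [y0 Ay0] /convex_set_segment Bc [b0 Bb0] AB0.
have AB y : A y -> B y -> False.
  by move=> Ay By; have : (A `&` B) y by []; rewrite AB0.
pose W : set 'rV[R]_n := [set z | z = 0 \/ exists (k : R) y b,
  [/\ 0 < k, A y, B b & z = k *: (y - b)]].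
have W_AB y b : A y -> B b -> W (y - b).
  by move=> Ay Bb; right; exists 1, y, b; rewrite scale1r.
(* Convexity of [A] and [B], with weights [k / (k + l)] and [l / (k + l)], closes the cone under
   addition. *)
have WA (k l : R) y b y' b' : 0 < k -> 0 < l -> A y -> A y' -> B b -> B b' ->
    exists2 y1, A y1 & exists2 b1, B b1 &
      k *: (y - b) + l *: (y' - b') = (k + l) *: (y1 - b1).
  move=> k0 l0 Ay Ay' Bb Bb'; pose t := k / (k + l).
  have kl0 : 0 < k + l by rewrite addr_gt0.
  have t01 : 0 <= t <= 1.
    rewrite ler_pdivrMr // mul1r lerDl (ltW l0) andbT.
    by rewrite divr_ge0 // ltW.
  exists (t *: y + (1 - t) *: y'); first exact: Ac.
  exists (t *: b + (1 - t) *: b'); first exact: Bc.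
  by apply/rowP => i; rewrite !mxE /t; field; rewrite gt_eqF.
have Wcone : pointed_cone W.
  split.
  - move=> z z' [->|[k [y [b [k0 Ay Bb ->]]]]]; first by rewrite add0r.
    case=> [->|[l [y' [b' [l0 Ay' Bb' ->]]]]].
      by rewrite addr0; right; exists k, y, b.
    have [y1 Ay1 [b1 Bb1 ->]] := WA _ _ _ _ _ _ k0 l0 Ay Ay' Bb Bb'.
    by right; exists (k + l), y1, b1; rewrite addr_gt0.
  - move=> l z; rewrite le_eqVlt => /predU1P[<-|l0].
      by rewrite scale0r; left.
    move=> [->|[k [y [b [k0 Ay Bb ->]]]]]; first by rewrite scaler0; left.
    by right; exists (l * k), y, b; rewrite scalerA mulr_gt0.
  - move=> z [//|[k [y [b [k0 Ay Bb ->]]]]].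
    case=> [/eqP|[l [y' [b' [l0 Ay' Bb' /eqP]]]]].
      by rewrite oppr_eq0 => /eqP.
    have [y1 Ay1 [b1 Bb1 E]] := WA _ _ _ _ _ _ k0 l0 Ay Ay' Bb Bb'.
    rewrite eq_sym -addr_eq0 addrC E scaler_eq0 gt_eqF ?addr_gt0 //= subr_eq0.
    by move=> /eqP yb; case: (AB b1) => //; rewrite -yb.
have [|C [Ccone WC Ctot]] := pointed_cone_total W Wcone.
  by exists 0; left.
have [Cadd Cscale _] := Ccone.
pose e := y0 - b0.
have [||z|a a0 Ca] := total_cone_functional C e Ccone Ctot.
- by apply: WC; exact: W_AB.
- by rewrite subr_eq0; apply/eqP => yb; apply: (AB b0) => //; rewrite -yb.
(* The vector [e] is an order unit: [y0 - eps *: z] stays in [A] for some [eps > 0], so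
   [e - eps *: z] is in the cone. *)
- have [eps eps0 Aeps] := open_absorbing _ _ _ _ (- z) Ao Ay0.
  exists eps^-1; have -> : eps^-1 *: e - z = eps^-1 *: (y0 + eps *: - z - b0).
    by apply/rowP => i; rewrite !mxE; field; rewrite gt_eqF.
  by apply: Cscale; [rewrite invr_ge0 ltW|apply/WC; exact: W_AB].
exists a => // y b Ay Bb.
(* The weak inequality at [y - eps *: a] is strict at [y], with gap [eps * dotv a a]. *)
have [eps eps0 Aeps] := open_absorbing _ _ _ _ (- a) Ao Ay.
have := Ca _ (WC _ (W_AB _ _ Aeps Bb)).
rewrite dotvBr dotvDr dotvZr -scaleN1r dotvZr mulN1r subr_ge0 => /le_lt_trans.
by apply; rewrite mulrN gtrBl mulr_gt0 // dotv_gt0.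
Qed.

(** * Segments and rays meeting an open convex set and its boundary *)

Section OpenConvex.
Context {R : realType} {n : nat} (I : set 'rV[R]_n).
Hypotheses (Io : open I) (Ic : convex_set I).
Implicit Types p q x y b v : 'rV[R]_n.

Lemma exteriorE : exterior I = ~` closure I.
Proof.
apply/seteqP; split => z; rewrite /exterior /boundary ((interior_id I).1 Io).
  move=> zext cz; apply: zext; have [Iz|Iz] := pselect (I z); first by right.
  by left; split.
by move=> zc [[? _]|Iz]; apply: zc => //; exact: subset_closure.
Qed.

(** Replace [b] by a nearby [z] in [I]: the point is also [s *: w + (1 - s) *: z] with
    [w = y + k *: (b - z)], which is close enough to [y] to lie in [I]. *)
Lemma open_segment_closure b y (s : R) :
  closure I b -> I y -> 0 < s <= 1 -> I (b + s *: (y - b)).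
Proof.
move=> cb Iy /andP[s0 s1].
have /nbhs_ballP[e /= e0 eI] : nbhs y I by exact: open_nbhs_nbhs.
pose k := (1 - s) / s.
have k0 : 0 <= k by rewrite divr_ge0 ?subr_ge0 // ltW.
have k10 : 0 < k + 1 by rewrite ltr_wpDl.
have [z [Iz [_ bz]]] := cb _ (nbhsx_ballx b _ (divr_gt0 e0 k10)).
have Iw : I (y + k *: (b - z)).
  apply: eI; split=> // i j; rewrite !mxE /ball /= opprD addNKr normrN normrM.
  rewrite (ger0_norm k0); have := bz i j; rewrite /ball /= ltr_pdivlMr //.
  by apply: le_lt_trans; rewrite mulrC ler_wpM2l // lerDl.
have /convex_set_segment/(_ (y + k *: (b - z)) z s) := Ic.
rewrite s1 ltW // => /(_ isT Iw Iz); congr I.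
by apply/rowP => i; rewrite !mxE /k; field; rewrite gt_eqF.
Qed.

(** The crossing is at the infimum of the nonnegative parameters whose point lies in [I]; were that
    point in [I], openness would give a smaller such parameter. *)
Lemma boundary_crossing p y :
  ~ closure I p -> I y ->
  exists2 s : R, 0 <= s <= 1 & boundary I (p + s *: (y - p)).
Proof.
move=> cp Iy; pose f (s : R) := p + s *: (y - p).
pose A : set R := [set s | 0 <= s /\ I (f s)].
have A1 : A 1 by split; rewrite ?ler01 // /f scale1r addrC subrK.
have hA : has_inf A by split; [exists 1|exists 0 => s []].
have i1 : inf A <= 1 by apply: ge_inf => //; case: hA.
have i0 : 0 <= inf A by apply: lb_le_inf; [exists 1|move=> s []].
exists (inf A); first by rewrite i0 i1.
split.
  move=> B fB; have := @continuous_line R n p (y - p) (inf A) _ fB.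
  move=> /nbhs_ballP[e /= e0 eB]; have [s As slt] := inf_adherent e0 hA.
  exists (f s); split; first by case: As.
  apply: eB; rewrite /ball /= distrC ger0_norm ?ltrBlDl //.
  by rewrite subr_ge0; apply: ge_inf => //; case: hA.
rewrite ((interior_id I).1 Io) => If.
have i_neq0 : inf A != 0.
  apply/eqP => i00; apply: cp; apply: subset_closure.
  by move: If; rewrite i00 scale0r addr0.
have /= [e e0 Ie] := open_absorbing _ _ _ _ (p - y) Io If.
(* Stepping back by at most [e] stays in [I], and by at most [inf A] keeps the parameter
   nonnegative. *)
pose d := Num.min e (inf A).
have d0 : 0 < d by rewrite lt_min e0 lt_def i_neq0 i0.
have Id : I (f (inf A - d)).
  have : I (f (inf A) + (d / e) *: (f (inf A) + e *: (p - y) - f (inf A))).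
    apply: open_segment_closure => //; first exact: subset_closure.
    by rewrite divr_gt0 //= ler_pdivrMr // mul1r ge_min lexx.
  congr I; apply/rowP => i; rewrite !mxE; field.
  by rewrite gt_eqF.
have : A (inf A - d) by split=> //; rewrite subr_ge0 ge_min lexx orbT.
by move=> /(ge_inf hA.2); rewrite lerBrDr gerDl leNgt d0.
Qed.

(** A ray missing [I] is separated from it by some [a]. On the ray [dotv a] is maximal at the
    boundary point, which is not the endpoint, so it is constant there and its level set is a
    forbidden supporting hyperplane. *)
Lemma ray_meets_interior p q : I !=set0 ->
  exterior I p -> ray p q `&` boundary I !=set0 ->
  ~ (exists H, supporting_hyperplane I H /\ ray p q `<=` H) ->
  ray p q `&` I !=set0.
Proof.
move=> I0 pext [b [[t0 /= t00 bE] Kb]] nosupp.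
apply: contrapT => /set0P/negP; rewrite negbK => /eqP rayI.
have rc : convex_set (ray p q).
  apply/convex_set_segment => _ _ s /andP[s0 s1] [t /= ht <-] [u /= hu <-].
  exists (s * t + (1 - s) * u) => /=.
    by rewrite addr_ge0 // mulr_ge0 // subr_ge0.
  by apply/rowP => i; rewrite !mxE; ring.
have rp : ray p q p by exists 0 => //=; rewrite scale0r addr0.
have [||a a0 sep] := convex_separation _ _ _ _ Io Ic I0 rc.
- by exists p.
- by rewrite setIC.
apply: nosupp.
have [e Ie] := I0.
have cb : closure I b by case: Kb.
have b_max z : ray p q z -> dotv a z <= dotv a b.
  move=> rz; apply/ler_addgt0Pr => eps eps0.
  have rb : ray p q b by exists t0.
  have bep : 0 < dotv a (e - b) by rewrite dotvBr subr_gt0 sep.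
  (* Chosen so that [s * dotv a (e - b) <= eps] and [0 < s <= 1]. *)
  pose s := eps / (eps + dotv a (e - b)).
  have den0 : 0 < eps + dotv a (e - b) by rewrite addr_gt0.
  have s01 : 0 < s <= 1.
    by rewrite divr_gt0 //= ler_pdivrMr // mul1r lerDl ltW.
  apply: ltW; apply: lt_le_trans (sep _ _ (open_segment_closure _ _ _ cb Ie s01) rz) _.
  rewrite dotvDr dotvZr lerD2l /s mulrAC ler_pdivrMr // ler_pM2l //.
  by rewrite lerDr ltW.
have t0_gt0 : 0 < t0.
  rewrite lt_def t00 andbT; apply/eqP => t0E; move: pext; rewrite exteriorE; apply.
  by move: cb; rewrite -bE t0E scale0r addr0.
(* Comparing the maximum at [t0] with parameters [0] and [t0 + 1] forces slope zero. *)
have av : dotv a (q - p) = 0.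
  have := b_max _ rp; rewrite -bE dotvDr dotvZr lerDl pmulr_rge0 //.
  move=> av0; apply/eqP; rewrite eq_le av0 andbT.
  have : dotv a (p + (t0 + 1) *: (q - p)) <= dotv a b.
    by apply: b_max; exists (t0 + 1) => //=; rewrite addr_ge0.
  by rewrite -bE !(dotvDr a p) !dotvZr lerD2l mulrDl mul1r gerDl.
have rH : ray p q `<=` [set z | dotv a z = dotv a p].
  by move=> _ [t _ <-] /=; rewrite dotvDr dotvZr av mulr0 addr0.
exists [set z | dotv a z = dotv a p]; split=> //.
exists a, (dotv a p); split=> //.
  by exists b; split => //; apply: rH; exists t0.
by right=> y Iy /=; exact: sep.
Qed.

(** * The Funk distance by ray parameters and the description of the set *)

Lemma funk_first_hit (p x : 'rV[R]_n) (t : R) :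
  p != x -> 1 < t -> first_hit (boundary I) p x (p + t *: (x - p)) ->
  funk I p x = ln (t / (t - 1)).
Proof.
move=> px t1 hit; rewrite /funk.
have -> : hit_point (boundary I) p x = p + t *: (x - p).
  apply: (first_hit_uniq _ hit); apply: hit_pointP; first exact: closed_boundary.
  by have [s [s0 -> Ks _]] := hit; exists (p + s *: (x - p)); split=> //; exists s.
have edist_scale (q : 'rV[R]_n) (k : R) :
    Defs.edist q (q + k *: (x - p)) = `|k| * Defs.edist p x.
  rewrite /Defs.edist -sqrtr_sqr -sqrtrM ?sqr_ge0 //; congr Num.sqrt.
  rewrite mulr_sumr; apply: eq_bigr => i _; rewrite !mxE; ring.
have -> : Defs.edist x (p + t *: (x - p)) = (t - 1) * Defs.edist p x.
  rewrite -[t - 1]ger0_norm ?subr_ge0 1?ltW // -(edist_scale x); congr Defs.edist.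
  by apply/rowP => i; rewrite !mxE; ring.
rewrite edist_scale ger0_norm; last by rewrite ltW // (lt_trans _ t1).
rewrite -mulf_div divff ?mulr1 // gt_eqF // sqrtr_gt0 dotv_gt0 //.
by rewrite subr_eq0.
Qed.

Lemma lt_ln_ratio (M t : R) : 0 < M -> 1 < t ->
  (M < ln (t / (t - 1))) = ((t - 1) * (expR M - 1) < 1).
Proof.
move=> M0 t1; have t10 : 0 < t - 1 by rewrite subr_gt0.
have t0 : 0 < t by rewrite (lt_trans _ t1).
rewrite -ltr_expR lnK ?posrE ?divr_gt0 // ltr_pdivlMr // -subr_gt0.
by rewrite -[RHS]subr_gt0; congr (0 < _); ring.
Qed.

(** The correspondence is [y = p + s *: (x - p)] with [r = (s - 1)^-1], so [r > nu] says that the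
    ray is in [I] at some parameter below [1 + 1 / nu]. *)
Lemma funk_setP (x p : 'rV[R]_n) (M : R) :
  I !=set0 -> exterior I x -> 0 < M ->
  funk_set I x M p <->
  exists y (r : R), [/\ I y, expR M - 1 < r & p = x + r *: (x - y)].
Proof.
move=> I0 xext M0; have xcl : ~ closure I x by move: xext; rewrite exteriorE.
have nu0 : 0 < expR M - 1 by rewrite subr_gt0 expR_gt1.
split.
- move=> [pext [[_ _ px] hitK nosupp segK]].
  have [t [t0 bE Kb tmin]] := hit_pointP (@closed_boundary _ I) hitK.
  have t1 : 1 < t.
    rewrite ltNge; apply/negP => t1.
    have : (segment p x `&` boundary I) (p + t *: (x - p)).
      by split; [exists t => //=; rewrite t0|rewrite -bE].
    by rewrite segK.
  rewrite (@funk_first_hit p x t) //; last by exists t; split=> //; rewrite -bE.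
  rewrite lt_ln_ratio // => tM.
  have [_ [[u /= u0 <-] Iy]] := ray_meets_interior _ _ I0 pext hitK nosupp.
  (* Otherwise the boundary would be crossed between [p] and the point of [I], before the first
     hit. *)
  have tu : t <= u.
    rewrite leNgt; apply/negP => ut.
    have [|s /andP[s0 s1] Ks] := boundary_crossing p _ _ Iy.
      by move: pext; rewrite exteriorE.
    apply: (tmin (s * u)).
      by rewrite mulr_ge0 //=; apply: le_lt_trans ut; rewrite ler_piMl.
    by move: Ks; rewrite addrAC subrr add0r scalerA.
  have [s [s1 Is sM]] : exists s : R, [/\ 1 < s, I (p + s *: (x - p)) &
      (s - 1) * (expR M - 1) < 1].
    (* Here [d] is the slack in the bound at [t], and [w] the cost of moving to [u]; moving by the
       fraction [d / (d + w)] costs less than [d]. *)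
    pose d := 1 - (t - 1) * (expR M - 1).
    pose w := (u - t) * (expR M - 1).
    have d0 : 0 < d by rewrite subr_gt0.
    have w0 : 0 <= w by apply: mulr_ge0; [rewrite subr_ge0|exact: ltW].
    have dw0 : 0 < d + w by rewrite ltr_wpDr.
    have c01 : 0 < d / (d + w) <= 1.
      by rewrite divr_gt0 //= ler_pdivrMr // mul1r lerDl.
    exists (t + d / (d + w) * (u - t)); split.
    + by rewrite ltr_wpDr // mulr_ge0 ?subr_ge0 // ltW //; case/andP: c01.
    + have cb : closure I (p + t *: (x - p)) by rewrite -bE; case: Kb.
      have := open_segment_closure _ _ _ cb Iy c01; congr I.
      by apply/rowP => i; rewrite !mxE; ring.
    + have -> : (t + d / (d + w) * (u - t) - 1) * (expR M - 1) =
          1 - d + d * (w / (d + w)).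
        by rewrite /d /w; ring.
      rewrite -addrA gtrDl addrC subr_lt0 gtr_pMr // ltr_pdivrMr // mul1r.
      by rewrite ltrDr.
  have s10 : 0 < s - 1 by rewrite subr_gt0.
  exists (p + s *: (x - p)), (s - 1)^-1; split=> //.
    by rewrite -[ltRHS]mul1r ltr_pdivlMr // mulrC.
  by apply/rowP => i; rewrite !mxE; field; rewrite gt_eqF.
- move=> [y [r [Iy rM pE]]].
  have r0 : 0 < r by exact: lt_trans rM.
  (* The point [x] lies strictly between [p] and [y]; with [p] in the closure it would be in [I]. *)
  have pcl : ~ closure I p.
    move=> cp; apply: xcl; apply: subset_closure.
    have /(open_segment_closure _ _ _ cp Iy) : 0 < r / (1 + r) <= 1.
      have r10 : 0 < 1 + r by rewrite addr_gt0.
      by rewrite divr_gt0 //= ler_pdivrMr // mul1r lerDr.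
    congr I; rewrite pE; apply/rowP => i; rewrite !mxE; field.
    by rewrite gt_eqF // addr_gt0.
  have yE : y = p + (1 + r^-1) *: (x - p).
    by rewrite pE; apply/rowP => i; rewrite !mxE; field; rewrite gt_eqF.
  have px : p != x.
    rewrite pE -subr_eq0 addrAC subrr add0r scaler_eq0 gt_eqF //= subr_eq0.
    by apply/eqP => xy; apply: xcl; apply: subset_closure; rewrite xy.
  have pext : exterior I p by rewrite exteriorE.
  have ri0 : 0 < r^-1 by rewrite invr_gt0.
  (* A boundary point before [x], joined to [y] beyond [x], would put [x] in [I]. *)
  have seg_cl s : 0 <= s <= 1 -> ~ boundary I (p + s *: (x - p)).
    move=> /andP[s0 s1] [cs _]; apply: (xcl); apply: subset_closure.
    have [sE|s_neq1] := eqVneq s 1.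
      by case: xcl; move: cs; rewrite sE scale1r addrC subrK.
    have s1' : 0 < 1 - s by rewrite subr_gt0 lt_def eq_sym s_neq1.
    have den : 0 < 1 - s + r^-1 by rewrite addr_gt0.
    have /(open_segment_closure _ _ _ cs Iy) : 0 < (1 - s) / (1 - s + r^-1) <= 1.
      by rewrite divr_gt0 //= ler_pdivrMr // mul1r lerDl ltW.
    congr I; rewrite yE; apply/rowP => i; rewrite !mxE; field.
    rewrite gt_eqF //=; apply: lt0r_neq0.
    by have := mulr_gt0 den r0; rewrite mulrDl mulVf ?gt_eqF.
  have [s /andP[s0 s1] Ks] := boundary_crossing p y pcl Iy.
  have {}Ks : boundary I (p + (s * (1 + r^-1)) *: (x - p)).
    by move: Ks; rewrite {1}yE addrAC subrr add0r scalerA.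
  have r10 : 0 < 1 + r^-1 by rewrite addr_gt0.
  have hitK : ray p x `&` boundary I !=set0.
    eexists; split; last exact: Ks.
    by exists (s * (1 + r^-1)) => //=; rewrite mulr_ge0 // ltW.
  split=> //.
    split=> //.
    (* The ray contains [y], a point of [I], whereas a supporting hyperplane misses [I]. *)
    + move=> [H [[a [c [a0 HE _ IH]]] rH]].
      have : H y by apply: rH; rewrite yE; exists (1 + r^-1) => //=; exact: ltW.
      rewrite HE /= => ay; have := IH; case=> /(_ _ Iy) /=; rewrite ay ltxx //.
    + rewrite -subset0 => _ [[u /= u01 <-]]; exact: seg_cl.
  have [t [t0 bE Kb tmin]] := hit_pointP (@closed_boundary _ I) hitK.
  have t1 : 1 < t.
    rewrite ltNge; apply/negP => t1.
    by apply: (seg_cl t); [rewrite t0|rewrite -bE; exact: Kb].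
  have hit : first_hit (boundary I) p x (p + t *: (x - p)).
    by rewrite -bE; apply: hit_pointP hitK; exact: closed_boundary.
  rewrite (@funk_first_hit p x t px t1 hit).
  (* The first hit is no later than the crossing on the segment from [p] to [y], which is not at [y]
     itself because [I] is open. *)
  have tr : t < 1 + r^-1.
    have st : t <= s * (1 + r^-1).
      rewrite leNgt; apply/negP => lt_st; apply: (tmin _ _ Ks).
      by rewrite lt_st mulr_ge0 // ltW.
    apply: le_lt_trans st _; rewrite gtr_pMl // lt_neqAle s1 andbT.
    apply/eqP => sE; move: Ks; rewrite sE mul1r -yE => -[_]; apply.
    by rewrite ((interior_id I).1 Io).
  rewrite lt_ln_ratio //.
  have : (t - 1) * r < 1 by rewrite -ltr_pdivlMr // mul1r ltrBlDl.
  by apply: lt_trans; rewrite ltr_pM2l // subr_gt0.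
Qed.

End OpenConvex.

(** * Convexity of the superlevel set *)

Theorem theorem5p7 (R : realType) (n : nat) (I : set 'rV[R]_n)
    (I_nonempty : I !=set0)
    (I_open : open I)
    (I_convex : convex_set I)
    (I_proper : I <> setT)
    (K_strictly_convex : strictly_convex (boundary I))
    (x : 'rV[R]_n) (x_ext : exterior I x)
    (M : R) (M_gt0 : 0 < M) :
  funk_set I x M `<=` exterior I /\ convex_set (funk_set I x M).
Proof.
split; first by move=> p [].
apply/convex_set_segment => p1 p2 t /andP[t0 t1].
have funkP := funk_setP I I_open I_convex x _ M I_nonempty x_ext M_gt0.
move=> /funkP[y1 [r1 [Iy1 r1M ->]]] /funkP[y2 [r2 [Iy2 r2M ->]]].
apply/funkP; pose nu := expR M - 1.
have nu0 : 0 < nu by rewrite subr_gt0 expR_gt1.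
pose r := t * r1 + (1 - t) * r2.
have u0 : 0 <= 1 - t by rewrite subr_ge0.
have a0 : 0 <= t * r1 by rewrite mulr_ge0 // ltW // (lt_trans nu0).
have b0 : 0 <= (1 - t) * r2 by rewrite mulr_ge0 // ltW // (lt_trans nu0).
have rM : nu < r.
  (* Strictness comes from the first term, which vanishes when [t = 0]. *)
  have [tE|t_neq0] := eqVneq t 0; first by rewrite /r tE mul0r subr0 mul1r add0r.
  have -> : nu = t * nu + (1 - t) * nu by ring.
  by apply: ltr_leD; [rewrite ltr_pM2l // lt_def t_neq0|rewrite ler_wpM2l // ltW].
have r0 : 0 < r by exact: lt_trans rM.
(* These weights give [r *: y = (t * r1) *: y1 + ((1 - t) * r2) *: y2] for the witness [y]. *)
exists ((t * r1 / r) *: y1 + (1 - t * r1 / r) *: y2), r; split=> //.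
  move/convex_set_segment : I_convex; apply=> //.
  by rewrite divr_ge0 ?(ltW r0) //= ler_pdivrMr // mul1r lerDl.
by apply/rowP => i; rewrite !mxE /r; field; rewrite gt_eqF.
Qed.
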